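(* Let $\alpha$ be a $k$-adic connective that is non-linear and self-dual, and let the support of $\mu$ comprise exactly the $n$ projections and their $n$ negations. Then the growth process $(\mu,\alpha)$ has a limiting distribution, and it is uniform over the family of self-dual $n$-adic Boolean functions.
   Context: A connective is a $k$-adic Boolean function $\alpha:\{0,1\}^k\to\{0,1\}$. The initial distribution $\mu$ is uniform on its support, here the set of projections $x_1,\dots,x_n$ and negated projections $\bar x_1,\dots,\bar x_n$ on $n$ variables. The growth process $(\mu,\alpha)$ gives distributions $\pi_i$ on $n$-adic Boolean functions: $\pi_0=\mu$, and for $i\ge1$, $\pi_i(f)$ is the probability that $\alpha(g_1,\dots,g_k)=f$ where $g_1,\dots,g_k$ are independent random functions distributed according to $\pi_{i-1}$. The limiting distribution is $\pi=\lim_{i\to\infty}\pi_i$ (pointwise). A Boolean function is linear if it has the form $c_0\oplus c_1y_1\oplus\cdots\oplus c_ky_k$ with $c_j\in GF(2)$. A Boolean function $f$ of $m$ variables is self-dual if $f(y_1,\dots,y_m)=\overline{f(\bar y_1,\dots,\bar y_m)}$ for all $y$. *)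

(* Defs.v *)
From HB Require Import structures.
From mathcomp Require Import all_boot all_order all_algebra.
From mathcomp Require Import all_classical all_reals all_analysis.

Set Implicit Arguments.
Unset Strict Implicit.
Unset Printing Implicit Defensive.

Import Order.TTheory GRing.Theory Num.Theory.
Import numFieldNormedType.Exports.
Local Open Scope classical_set_scope.
Local Open Scope ring_scope.

Notation cube m := {ffun 'I_m -> bool}.

Notation boolfun m := {ffun cube m -> bool}.

Definition compl (m : nat) (y : cube m) : cube m := [ffun j => ~~ y j].

Definition proj (m : nat) (i : 'I_m) : boolfun m := [ffun y : cube m => y i].

Definition negproj (m : nat) (i : 'I_m) : boolfun m :=
  [ffun y : cube m => ~~ y i].

Definition literals (n : nat) : {set boolfun n} :=
  ([set proj i | i : 'I_n] :|: [set negproj i | i : 'I_n])%SET.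

(* GF(2) is rendered as bool, with addition addb and multiplication andb. *)
Definition linear_boolfun (m : nat) (f : boolfun m) : Prop :=
  exists (c0 : bool) (c : 'I_m -> bool),
    forall y : cube m, f y = c0 (+) \big[addb/false]_(j < m) (c j && y j).

Definition self_dual (m : nat) (f : boolfun m) : bool :=
  [forall y : cube m, f y == ~~ f (compl y)].

Definition connect_apply (k n : nat) (alpha : boolfun k)
    (g : {ffun 'I_k -> boolfun n}) : boolfun n :=
  [ffun y : cube n => alpha [ffun j => g j y]].

Definition distribution (R : realType) (T : finType) (p : T -> R) : Prop :=
  (forall x, 0 <= p x) /\ \sum_x p x = 1.

(* Requiring p to be a distribution rules out an empty A. *)
Definition uniform_over (R : realType) (T : finType) (A : {set T})
    (p : T -> R) : Prop :=
  distribution p /\ forall x, p x = if x \in A then #|A|%:R^-1 else 0.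

(* The law of alpha(g_1, ..., g_k) for independent g_j with law p; by
   independence a tuple g has probability \prod_j p (g j). *)
Definition growth_step (R : realType) (k n : nat) (alpha : boolfun k)
    (p : boolfun n -> R) : boolfun n -> R :=
  fun f => \sum_(g : {ffun 'I_k -> boolfun n} | connect_apply alpha g == f)
             \prod_(j < k) p (g j).

Definition growth (R : realType) (k n : nat) (mu : boolfun n -> R)
    (alpha : boolfun k) (i : nat) : boolfun n -> R :=
  iter i (growth_step alpha) mu.

Definition limiting_distribution (R : realType) (k n : nat)
    (mu : boolfun n -> R) (alpha : boolfun k) (p : boolfun n -> R) : Prop :=
  distribution p /\
  forall f : boolfun n, growth mu alpha i f @[i --> \oo] --> p f.

(* Main.v *)
Require Import Defs.
From mathcomp Require Import all_boot all_order all_algebra.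
From mathcomp Require Import reals lra ring.

Set Implicit Arguments.
Unset Strict Implicit.
Unset Printing Implicit Defensive.

Import Order.TTheory GRing.Theory Num.Theory.
Local Open Scope ring_scope.

(** A law [p] on Boolean functions is studied through its Walsh coefficients: [bias p w] is the
    expectation of the product of (-1)^(f y) over y in w. Expanding (-1)^alpha in its own
    coefficients a_S turns one growth step into an exact recurrence ([bias_growth_stepE]): a bias b
    of w becomes the sum over S of a_S^|w| b^|S|, plus a term [mixed] in which every summand
    contains the bias of a nonempty proper subset of w. By induction on |w|, [mixed] tends to 0.

    For |w| >= 2 the diagonal sum is at most |b|, because self-duality kills a_S at the empty set
    and Parseval bounds the rest. Non-linearity supplies S0 with |S0| >= 2 and 0 < |a_S0| < 1
    ([fourier_nonlinear], [fourier_linear]), which makes the step a strict contraction: through a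
    spare factor |a_S0| when |w| >= 3, and through |b|^|S0| <= |b|^2 when |w| = 2, provided |b| < 1
    at the start. Singletons have bias 0 throughout, as the literals are closed under negation.

    A self-dual function is determined by its values on a half cube, where no two points are
    antipodal. There every nonempty bias vanishes in the limit ([bias_half_cube_cvg0]), so Walsh
    inversion ([half_cube_inversion]) gives all self-dual functions the same limit mass;
    conservation of total mass identifies it ([card_self_dual]). *)

(** * Walsh characters, inversion and Parseval *)

Section Walsh.
Variables (R : realFieldType) (I : finType).
Implicit Types (S H : {set I}) (x y z : {ffun I -> bool}).
Implicit Types f : {ffun {ffun I -> bool} -> bool}.

(** The index type is generic because characters occur at two levels: over ['I_k] to expand the
    connective, and over [cube n], with a Boolean function in the place of [x], to expand a law on
    functions. *)
Definition walsh S x : R := \prod_(i in S) (-1) ^+ x i.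

Lemma walshE S x : walsh S x = (-1) ^+ \big[addb/false]_(i in S) x i.
Proof.
symmetry; exact: (big_morph _ (@signr_addb R) (expr0 _ : (-1) ^+ false = 1)).
Qed.

Lemma normr_walsh S x : `|walsh S x| = 1.
Proof. by rewrite walshE normr_sign. Qed.

(** The sum is the expansion of the product over [H] of 1 + (-1)^(x i) (-1)^(z i), whose factors are
    2 or 0. The full [H] gives orthogonality; a half cube gives inversion for self-dual
    functions. *)
Lemma sum_walshM H x z :
  \sum_(S : {set I} | S \subset H) walsh S x * walsh S z =
  if [forall i in H, x i == z i] then 2 ^+ #|H| else 0.
Proof.
pose s i : R := (-1) ^+ x i * (-1) ^+ z i.
have sE i : s i + 1 = if x i == z i then 2 else 0.
  rewrite /s -signr_addb; case: (x i); case: (z i);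
    by rewrite /= ?expr0 ?expr1 ?addNr // -natr1.
transitivity (\prod_(i in H) (s i + 1)); last first.
  case: ifPn => [/forall_inP xz|].
    rewrite (eq_bigr (fun=> 2)) ?prodr_const // => i iH.
    by rewrite sE xz.
  rewrite negb_forall_in => /exists_inP[i iH /negbTE xzi].
  by rewrite (bigD1 i) //= sE xzi mul0r.
rewrite [RHS]big_mkcond /=.
(* A zero summand outside [H] lets the product run over all indices; in the expansion it kills every
   [S] not contained in [H]. *)
rewrite [RHS](eq_bigr (fun i => (if i \in H then s i else 0) + 1)); last first.
  by move=> i _; case: ifP; rewrite ?add0r.
rewrite bigA_distr [LHS]big_mkcond; apply: eq_bigr => S _ /=.
case: ifPn => [sSH|/subsetPn[i iS iH]]; last first.
  by rewrite (bigD1 i) //= iS (negbTE iH) mul0r.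
rewrite -big_split big_mkcond; apply: eq_bigr => i _ /=.
by case: ifP => // /(subsetP sSH) ->.
Qed.

(** Walsh coefficient of the sign function (-1)^f, not of the 0/1-valued [f]. *)
Definition fourier f S : R :=
  2 ^- #|I| * \sum_x (-1) ^+ f x * walsh S x.

Lemma fourier_inversion f x : (-1) ^+ f x = \sum_S fourier f S * walsh S x.
Proof.
under eq_bigr do rewrite -mulrA mulr_suml.
rewrite -mulr_sumr exchange_big /=.
under eq_bigr => z _.
  under eq_bigr do rewrite -mulrA.
  rewrite -mulr_sumr.
  over.
have orth z : \sum_S walsh S z * walsh S x = if z == x then 2 ^+ #|I| else 0.
  rewrite -cardsT (_ : (z == x) = [forall i in [set: I], z i == x i]).
    by rewrite -sum_walshM; apply: eq_bigl => S; rewrite subsetT.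
  apply/eqP/forall_inP => [-> //|zx]; apply/ffunP => i.
  by apply/eqP/zx.
rewrite (bigD1 x) //= orth eqxx big1 => [|z /negbTE zx].
  by rewrite addr0 mulrCA mulVf ?mulr1 // expf_neq0 // pnatr_eq0.
by rewrite orth zx mulr0.
Qed.

Lemma parseval f : \sum_S fourier f S ^+ 2 = 1.
Proof.
under eq_bigr do rewrite expr2 {2}/fourier mulrCA mulr_sumr.
rewrite -mulr_sumr exchange_big /=.
under eq_bigr => x _.
  under eq_bigr do rewrite mulrCA.
  rewrite -mulr_sumr -fourier_inversion -signr_addb addbb expr0.
  over.
rewrite sumr_const card_ffun card_bool /=.
by rewrite natrX mulVf // expf_neq0 // pnatr_eq0.
Qed.

Lemma fourier_sqr_le1 f S : fourier f S ^+ 2 <= 1.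
Proof.
rewrite -(parseval f) (bigD1 S) //= lerDl.
by apply: sumr_ge0 => T _; exact: sqr_ge0.
Qed.

Lemma normr_fourier_le1 f S : `|fourier f S| <= 1.
Proof. by rewrite -(@expr_le1 _ 2) // real_normK ?num_real // fourier_sqr_le1. Qed.

Lemma fourier_concentrated f S T :
  fourier f S ^+ 2 = 1 -> T != S -> fourier f T = 0.
Proof.
move=> fS1 TS; have := parseval f.
rewrite (bigD1 S) //= fS1 (bigD1 T) //= => /eqP.
rewrite -[X in _ == X]addr0 (inj_eq (addrI 1)) paddr_eq0 ?sqr_ge0 ?sumr_ge0 //.
  by rewrite sqrf_eq0 => /andP[/eqP].
by move=> *; exact: sqr_ge0.
Qed.

End Walsh.

(** * The Fourier spectrum of the connective *)

Section Connective.
Variables (R : realFieldType) (k : nat) (alpha : boolfun k).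
Implicit Types (S : {set 'I_k}).
Local Notation "'a_ S" := (fourier R alpha S) (at level 8, S at level 2).

Lemma fourier_set0 : self_dual alpha -> fourier R alpha set0 = 0.
Proof.
move=> /forallP sd; rewrite /fourier.
suff -> : \sum_x (-1) ^+ alpha x * walsh R set0 x = 0 by rewrite mulr0.
under eq_bigr do rewrite /walsh big_set0 mulr1.
have complK : involutive (@compl k).
  by move=> x; apply/ffunP => j; rewrite !ffunE negbK.
(* Complementing the input flips the sign of every term. *)
set s := \sum_x _; suff : s = - s by lra.
rewrite {1}/s (reindex_inj (inv_inj complK)) -sumrN; apply: eq_bigr => x _.
by rewrite [in RHS](eqP (sd x)) signrN opprK.
Qed.

(** By Parseval all other coefficients vanish, so (-1)^alpha is plus or minus a single character. *)
Lemma fourier_linear S : fourier R alpha S ^+ 2 = 1 -> linear_boolfun alpha.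
Proof.
move=> S1; exists (fourier R alpha S == -1), (fun j => j \in S) => y.
have -> : \big[addb/false]_(j < k) ((j \in S) && y j) =
          \big[addb/false]_(j in S) y j.
  by rewrite [RHS]big_mkcond; apply: eq_bigr => j _; case: (j \in S).
apply: (@signr_inj R); rewrite signr_addb -walshE.
rewrite fourier_inversion (bigD1 S) //= big1 ?addr0 => [|T TS]; last first.
  by rewrite (fourier_concentrated S1 TS) mul0r.
congr (_ * _); move/eqP: S1; rewrite sqrf_eq1 => /orP[] /eqP ->.
  by rewrite -addr_eq0 -mulr2n pnatr_eq0.
by rewrite eqxx.
Qed.

                                                                              
                                                                            
                                                              
(** Otherwise the spectrum lives on singletons, the empty set being excluded by self-duality.
    Flipping one input bit then changes (-1)^alpha by twice a coefficient; a difference of two signs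
    being 0 or plus or minus 2, a nonzero coefficient is plus or minus 1 and [alpha] is linear. *)
Lemma fourier_nonlinear : self_dual alpha -> ~ linear_boolfun alpha ->
  exists2 S : {set 'I_k}, (1 < #|S|)%N & fourier R alpha S != 0.
Proof.
move=> sd nl.
have [S /andP[]|small] :=
  pickP (fun S : {set 'I_k} => (1 < #|S|)%N && (fourier R alpha S != 0)).
  by exists S.
have single S : fourier R alpha S != 0 -> exists j, S = [set j].
  move=> S0; apply/cards1P; have := small S; rewrite S0 andbT.
  have : S != set0 by apply: contraNneq S0 => ->; rewrite fourier_set0.
  by rewrite -cards_eq0; case: #|S| => [|[]].
have [S S0|all0] := pickP (fun S => fourier R alpha S != 0); last first.
  have /eqP := parseval R alpha; rewrite big1 ?(eq_sym 0) ?oner_eq0 // => S _.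
  by have /negbFE/eqP -> := all0 S; rewrite expr0n.
have [j Sj] := single S S0.
(* [x] and [z] differ only in coordinate [j], so only the character of [[set j]] distinguishes
   them. *)
pose x : cube k := [ffun=> false]; pose z : cube k := [ffun i => i == j].
have D : (-1) ^+ alpha x - (-1) ^+ alpha z = 2 * fourier R alpha S.
  rewrite !fourier_inversion -sumrB (bigD1 S) //= big1 => [|T TS].
    rewrite Sj /walsh !big_set1 !ffunE eqxx expr0 expr1; ring.
  have [->|T0] := eqVneq (fourier R alpha T) 0; first by rewrite !mul0r subrr.
  have [i Ti] := single T T0.
  have ij : (i == j) = false.
    by apply: contraNF TS => /eqP ij; rewrite Ti Sj ij.
  by rewrite Ti /walsh !big_set1 !ffunE ij subrr.
case: nl; apply: (@fourier_linear S).
move: S0 D; case: (alpha x); case: (alpha z); rewrite ?expr0 ?expr1 => S0 D.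
- by case/eqP: S0; lra.
- by have -> : fourier R alpha S = -1; [lra | rewrite sqrrN expr1n].
- by have -> : fourier R alpha S = 1; [lra | rewrite expr1n].
- by case/eqP: S0; lra.
Qed.
End Connective.

(** * The recurrence for biases under one growth step *)

Section Growth.
Variables (R : realType) (k n : nat) (alpha : boolfun k).
Implicit Types (p : boolfun n -> R) (w v : {set cube n}).
Local Notation a := (fourier R alpha).

Definition bias p w : R := \sum_f p f * walsh R w f.

Lemma sum_growth_step p (F : boolfun n -> R) :
  \sum_f growth_step alpha p f * F f =
  \sum_(g : {ffun 'I_k -> boolfun n})
     (\prod_j p (g j)) * F (connect_apply alpha g).
Proof.
rewrite [RHS](partition_big (connect_apply alpha) xpredT) //=.
apply: eq_bigr => f _; rewrite /growth_step mulr_suml.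
by apply: eq_bigr => g /eqP ->.
Qed.

Lemma growth_step_distribution p :
  distribution p -> distribution (growth_step alpha p).
Proof.
case=> p0 p1; split=> [f|]; first by apply: sumr_ge0 => g _; exact: prodr_ge0.
under eq_bigr do rewrite -[growth_step _ _ _]mulr1.
rewrite sum_growth_step; under eq_bigr do rewrite mulr1.
by rewrite -(bigA_distr_bigA (fun=> p)) prodr_const p1 expr1n.
Qed.

Lemma growth_step_self_dual p : self_dual alpha ->
    (forall f, ~~ self_dual f -> p f = 0) ->
  forall f, ~~ self_dual f -> growth_step alpha p f = 0.
Proof.
move=> /forallP sd p0 f; apply: contraNeq => gf0.
have [g /andP[/eqP <- g0]|none] :=
  pickP (fun g => (connect_apply alpha g == f) && (\prod_(j < k) p (g j) != 0)).
  have gsd j : self_dual (g j).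
    apply: contraNT g0 => /p0 gj0.
    by rewrite (bigD1 j) //= gj0 mul0r.
  apply/forallP => y; rewrite !ffunE (eqP (sd _)); apply/eqP; congr (~~ alpha _).
  apply/ffunP => j; rewrite !ffunE.
  by have /forallP/(_ y)/eqP -> := gsd j; rewrite negbK.
case/eqP: gf0; apply: big1 => g gE.
by have := none g; rewrite gE => /negbFE/eqP.
Qed.

Lemma bias_set0 p : distribution p -> bias p set0 = 1.
Proof.
case=> _ p1; rewrite -[RHS]p1; apply: eq_bigr => f _.
by rewrite /walsh big_set0 mulr1.
Qed.

Lemma normr_bias_le1 p w : distribution p -> `|bias p w| <= 1.
Proof.
case=> p0 p1; rewrite -p1; apply: le_trans (ler_norm_sum _ _ _) _.
by apply: ler_sum => f _; rewrite normrM normr_walsh mulr1 ger0_norm.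
Qed.

(** For each point y of [w], a choice [s y] selects one character in the expansion of (-1)^alpha.
    Collecting the signs by argument j instead of by point gives the block of those y with j in
    [s y], and independence of the g_j factors the expectation over blocks. The value [set0] off [w]
    only makes [s] unique. *)
Lemma bias_growth_step p w :
  bias (growth_step alpha p) w =
  \sum_(s in pffun_on set0 (mem w) predT)
     (\prod_(y in w) a (s y)) * \prod_j bias p [set y in w | j \in s y].
Proof.
rewrite /bias sum_growth_step.
have walshE g : walsh R w (connect_apply alpha g) =
    \sum_(s in pffun_on set0 (mem w) predT)
       \prod_(y in w) (a (s y) * walsh R (s y) [ffun j => g j y]).
  transitivity (\prod_(y in w) \sum_S a S * walsh R S [ffun j => g j y]).
    by apply: eq_bigr => y _; rewrite ffunE fourier_inversion.
  exact: big_distr_big.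
under eq_bigr do rewrite walshE mulr_sumr.
rewrite exchange_big /=; apply: eq_bigr => s _.
(* Independence: the product of the expectations over j is one sum over tuples [g]. *)
rewrite bigA_distr_bigA mulr_sumr; apply: eq_bigr => g _.
rewrite !big_split /= mulrCA; congr (_ * (_ * _)).
rewrite /walsh (eq_bigr _ (fun y _ => big_mkcond _ _)) exchange_big /=.
apply: eq_bigr => j _; rewrite -big_mkcondr.
by apply: eq_big => y; rewrite ?inE // => _; rewrite ffunE.
Qed.

Definition intermediate w v := (v != set0) && (v \proper w).

                                                                         
                                             
(** The contribution of the choices [s] that are not constant on [w], expressed by the presence of a
    block of strictly smaller size, to which induction applies. *)
Definition mixed p w : R :=
  \sum_(s in pffun_on set0 (mem w) predT
       | [exists j : 'I_k, intermediate w [set y in w | j \in s y]])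
     (\prod_(y in w) a (s y)) * \prod_j bias p [set y in w | j \in s y].

(** If no block is intermediate, each j lies in all of the [s y] or in none, so [s] is constant on
    [w], equal to some S. Its blocks are then [w] for j in S and empty, of bias 1, for the
    others. *)
Lemma bias_growth_stepE p w : distribution p -> w != set0 ->
  bias (growth_step alpha p) w =
  \sum_S a S ^+ #|w| * bias p w ^+ #|S| + mixed p w.
Proof.
move=> dp /set0Pn[y0 y0w]; rewrite bias_growth_step.
rewrite (bigID (fun s : {ffun cube n -> {set 'I_k}} =>
  [exists j : 'I_k, intermediate w [set y in w | j \in s y]])) /= addrC.
congr (_ + _).
pose const (S : {set 'I_k}) : {ffun cube n -> {set 'I_k}} :=
  [ffun y => if y \in w then S else set0].
have block S j : [set y in w | j \in const S y] = if j \in S then w else set0.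
  apply/setP => y; rewrite inE ffunE; case yw: (y \in w); case: ifP;
    by rewrite /= ?inE ?yw.
(* Evaluation at a point [y0] of the nonempty [w] recovers the constant value. *)
rewrite (reindex_onto const (fun s => s y0)) /=; last first.
  move=> s /andP[/pffun_onP[/subsetP sw _]].
  rewrite negb_exists => /forallP noj; apply/ffunP => y; rewrite ffunE.
  case: ifPn => [yw|]; last by apply: contraNeq => sy; apply: sw; rewrite inE eq_sym.
  apply/setP => j; have := noj j; rewrite negb_and negbK.
  set b := [set _ in w | _].
  have yb z : z \in w -> (z \in b) = (j \in s z) by rewrite inE => ->.
  rewrite -!yb //; case/orP.
    by move=> /eqP ->; rewrite !inE.
  have bw : b \subset w by rewrite /b setIdE subsetIl.
  by rewrite properEneq bw andbT negbK => /eqP ->; rewrite yw y0w.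
apply: eq_big => [S|S _].
  rewrite [const S y0]ffunE y0w eqxx andbT.
  apply/andP; split.
    apply/pffun_onP; split=> [|//]; apply/subsetP => y; rewrite inE ffunE.
    by case: ifP => // _; rewrite eqxx.
  rewrite negb_exists; apply/forallP => j; rewrite block.
  by rewrite /intermediate; case: ifP => _; rewrite ?eqxx ?properxx ?andbF.
congr (_ * _).
  by rewrite -prodr_const; apply: eq_bigr => y yw; rewrite ffunE yw.
rewrite -prodr_const [RHS]big_mkcond; apply: eq_bigr => j _.
by rewrite block; case: ifP; rewrite ?bias_set0.
Qed.

Lemma normr_mixed_le p w : distribution p ->
  `|mixed p w| <=
  #|{ffun cube n -> {set 'I_k}}|%:R *
    \sum_(v : {set cube n} | intermediate w v) `|bias p v|.
Proof.
move=> dp; set M := \sum_(v | _) _.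
have M0 : 0 <= M by apply: sumr_ge0.
apply: le_trans (ler_norm_sum _ _ _) _.
(* The crude bound counts all functions [s]; each mixed term costs at most one copy of [M], since it
   contains one intermediate bias and its other factors are at most 1 in absolute value. *)
rewrite mulr_natl -sumr_const [leRHS](bigID (fun s : {ffun cube n -> {set 'I_k}} =>
  (s \in pffun_on set0 (mem w) predT) &&
  [exists j : 'I_k, intermediate w [set y in w | j \in s y]])) /=.
rewrite -[leLHS]addr0 lerD ?sumr_ge0 // ler_sum // => s /andP[_].
case/existsP => j jw; rewrite normrM -[leRHS]mul1r ler_pM //.
  rewrite normr_prod prodr_ile1 // => y _; by rewrite normr_ge0 normr_fourier_le1.
rewrite normr_prod (bigD1 j) //= -[leRHS]mulr1 ler_pM //.
- by apply: prodr_ge0.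
- by rewrite /M (bigD1 _ jw) /= lerDl sumr_ge0.
by rewrite prodr_ile1 // => i _; rewrite normr_ge0 normr_bias_le1.
Qed.

(** For S other than [S0], |a_S|^m <= a_S^2 and |b|^|S| <= |b|, the empty S having coefficient 0.
    Parseval sums these weights to 1 - a_S0^2, and [theta] records the saving at [S0]. *)
Lemma sum_fourier_exp_le (m : nat) (b theta : R) (S0 : {set 'I_k}) :
    self_dual alpha -> (1 < m)%N -> `|b| <= 1 ->
    `|a S0| ^+ m * `|b| ^+ #|S0| <= a S0 ^+ 2 * theta * `|b| ->
  `|\sum_S a S ^+ m * b ^+ #|S| | <=
  (1 - a S0 ^+ 2 + a S0 ^+ 2 * theta) * `|b|.
Proof.
move=> sd m1 b1 hS0.
have -> : 1 - a S0 ^+ 2 = \sum_(S | S != S0) a S ^+ 2.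
  by rewrite -(parseval R alpha) (bigD1 S0) //= addrAC subrr add0r.
rewrite (bigD1 S0) //= addrC; apply: le_trans (ler_normD _ _) _.
rewrite mulrDl lerD //; last by rewrite normrM !normrX.
apply: le_trans (ler_norm_sum _ _ _) _; rewrite mulr_suml.
apply: ler_sum => S _; rewrite normrM !normrX.
have [->|/set0Pn[j jS]] := eqVneq S set0.
  by rewrite fourier_set0 // normr0 !expr0n gtn_eqF ?(ltnW m1) ?mul0r.
rewrite ler_pM ?exprn_ge0 //.
  by rewrite -[leRHS]real_normK ?num_real // ler_wiXn2l // normr_fourier_le1.
rewrite -[leRHS]expr1 ler_wiXn2l // card_gt0; by apply/set0Pn; exists j.
Qed.

End Growth.

(** * Self-dual functions on a half cube *)

Section HalfCube.
Variables (R : realType) (n : nat) (i0 : 'I_n).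

                                                                          
                                                     
(** One point from each antipodal pair. Antipodal pairs must be avoided: under a law on self-dual
    functions their bias is always -1. *)
Definition half_cube : {set cube n} := [set y : cube n | ~~ y i0].

Lemma self_dual_eq_half (f g : boolfun n) : self_dual f -> self_dual g ->
  [forall y in half_cube, f y == g y] = (f == g).
Proof.
move=> /forallP sdf /forallP sdg; apply/forall_inP/eqP => [fg|-> //].
apply/ffunP => y; case: (boolP (y \in half_cube)) => [/fg/eqP //|].
rewrite inE negbK => y0; rewrite (eqP (sdf y)) (eqP (sdg y)).
by congr (~~ _); apply/eqP/fg; rewrite inE ffunE y0.
Qed.

(** Characters inside the half cube already separate self-dual functions, and [p] charges no
    others. *)
Lemma half_cube_inversion (p : boolfun n -> R) f :
    (forall g, ~~ self_dual g -> p g = 0) -> self_dual f ->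
  p f = 2 ^- #|half_cube| *
    \sum_(w : {set cube n} | w \subset half_cube) walsh R w f * bias p w.
Proof.
move=> psd sdf; rewrite /bias.
under eq_bigr do rewrite mulr_sumr.
rewrite exchange_big /=.
transitivity (2 ^- #|half_cube| *
    \sum_g p g * (if f == g then 2 ^+ #|half_cube| else 0)).
  rewrite (bigD1 f) //= eqxx big1 ?addr0 => [|g]; last first.
    by rewrite eq_sym => /negbTE ->; rewrite mulr0.
  by rewrite mulrCA mulVf ?mulr1 // expf_neq0 // pnatr_eq0.
congr (_ * _); apply: eq_bigr => g _.
under [RHS]eq_bigr do rewrite mulrCA.
rewrite -mulr_sumr sum_walshM.
have [sdg|nsdg] := boolP (self_dual g); first by rewrite self_dual_eq_half.
by rewrite psd // !mul0r.
Qed.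

End HalfCube.

(** * Biases of the initial distribution *)

Section Literals.
Variables (R : realType) (n : nat) (mu : boolfun n -> R).
Hypothesis mu_uniform : uniform_over (literals n) mu.

Let negf (f : boolfun n) : boolfun n := [ffun y => ~~ f y].

Lemma literals_neg f : (negf f \in literals n) = (f \in literals n).
Proof.
have negfK : involutive negf by move=> g; apply/ffunP => y; rewrite !ffunE negbK.
have sub g : g \in literals n -> negf g \in literals n.
  rewrite !inE => /orP[] /imsetP[i _ ->]; apply/orP; [right|left];
    by apply/imsetP; exists i => //; apply/ffunP => y; rewrite !ffunE ?negbK.
by apply/idP/idP => /sub //; rewrite negfK.
Qed.

(** With no variables there are no literals, and [mu] would have total mass 0. *)
Lemma uniform_literals_index : exists i : 'I_n, true.
Proof.
have [i _|no] := pickP (fun _ : 'I_n => true); first by exists i.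
have [[_ mu1] muE] := mu_uniform.
have /eqP := mu1; rewrite big1 ?(eq_sym 0) ?oner_eq0 // => f _.
rewrite muE; case: ifP => //.
by rewrite !inE => /orP[] /imsetP[i]; have := no i.
Qed.

Lemma uniform_literals_proj i : 0 < mu (proj i).
Proof.
have [_ ->] := mu_uniform.
have pi : proj i \in literals n by rewrite inE imset_f.
by rewrite pi invr_gt0 ltr0n card_gt0; apply/set0Pn; exists (proj i).
Qed.

Lemma uniform_literals_self_dual f : ~~ self_dual f -> mu f = 0.
Proof.
have [_ ->] := mu_uniform; case: ifP => // fL /negP[].
apply/forallP => y; move: fL.
by rewrite !inE => /orP[] /imsetP[i _ ->]; rewrite !ffunE ?negbK.
Qed.

Lemma bias_literals1 y : bias mu [set y] = 0.
Proof.
have negf_inj : injective negf.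
  by move=> f g /ffunP fg; apply/ffunP => z; have := fg z; rewrite !ffunE => /negb_inj.
suff : bias mu [set y] = - bias mu [set y] by lra.
rewrite {1}/bias (reindex_inj negf_inj) -sumrN; apply: eq_bigr => f _.
have [_ muE] := mu_uniform.
by rewrite !muE literals_neg /walsh !big_set1 ffunE signrN mulrN.
Qed.

(** Bias 1 or -1 would force the character to be constant on the literals, but [proj i0] takes equal
    values at y and z, while the projection to a coordinate where they differ does not. *)
Lemma bias_literals2 (i0 : 'I_n) (y z : cube n) : y i0 = z i0 -> y != z ->
  `|bias mu [set y; z]| < 1.
Proof.
move=> yz0 yz.
have [i yzi] : exists i, y i != z i.
  by apply/existsP; apply: contraR yz; rewrite negb_exists => /forallP yz;
     apply/eqP/ffunP => i; apply/eqP/negPn/yz.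
have [[mu0 mu1] _] := mu_uniform.
have strict (s : R) f : `|s| = 1 -> 0 < mu f -> s * walsh R [set y; z] f = -1 ->
    s * bias mu [set y; z] < 1.
  move=> s1 f0 sf; rewrite -mu1 /bias mulr_sumr (bigD1 f) //= [ltRHS](bigD1 f) //=.
  apply: ltr_leD; first by rewrite mulrCA sf; lra.
  apply: ler_sum => g _; rewrite mulrCA ler_piMr //.
  by rewrite (le_trans (ler_norm _)) // normrM s1 normr_walsh mulr1.
have walsh2 f : walsh R [set y; z] f = (-1) ^+ (f y != f z).
  rewrite /walsh big_setU1 ?inE //= big_set1.
  by case: (f y); case: (f z); rewrite /= ?expr0 ?expr1 ?mulr1 ?mul1r ?mulrNN ?mulr1.
rewrite ltr_norml -[X in X < _ < _]mulr1 mulN1r ltrNl -mulN1r; apply/andP; split.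
  apply: (strict _ (proj i0)); rewrite ?normrN1 ?uniform_literals_proj //.
  by rewrite walsh2 !ffunE yz0 eqxx mulr1.
rewrite -[X in X < _]mul1r.
apply: (strict _ (proj i)); rewrite ?normr1 ?uniform_literals_proj //.
by rewrite walsh2 !ffunE yzi mul1r.
Qed.

End Literals.

From mathcomp Require Import all_classical all_reals all_analysis.
Import numFieldNormedType.Exports.

(** * Convergence of the biases and of the growth process *)

Section Convergence.
Variable R : realType.
Local Open Scope classical_set_scope.

Lemma cvg_finsum (T : finType) (P : pred T) (u : T -> nat -> R) (l : T -> R) :
    (forall t, P t -> u t i @[i --> \oo] --> l t) ->
  (\sum_(t | P t) u t i) @[i --> \oo] --> \sum_(t | P t) l t.
Proof. by move=> ul; apply: cvg_big => //; exact: add_continuous. Qed.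

Lemma cvg0_contraction (u e : nat -> R) (q : R) :
    0 <= q < 1 -> (forall i, 0 <= u i) ->
    (forall i, u i.+1 <= q * u i + e i) ->
  e i @[i --> \oo] --> 0 -> u i @[i --> \oo] --> 0.
Proof.
move=> /andP[q0 q1] u0 ue e0; apply/cvgr0Pnorm_lt => d d0.
(* With errors below this threshold, d/2 is a fixed point of the bound: q d/2 + (1 - q) d/2 =
   d/2. *)
have d1 : 0 < d / 2 * (1 - q) by rewrite mulr_gt0 ?divr_gt0 ?subr_gt0.
have [N _ eN] := cvgr0_norm_lt _ e0 _ d1.
have uN m : u (m + N)%N <= q ^+ m * u N + d / 2.
  elim: m => [|m IHm]; first by rewrite expr0 mul1r lerDl divr_ge0 // ltW.
  apply: le_trans (ue _) _; rewrite exprS.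
  have := ltW (eN (m + N)%N (leq_addl _ _)).
  move=> /(le_trans (ler_norm _)) em; have := ler_wpM2l q0 IHm; lra.
have qu : q ^+ m * u N @[m --> \oo] --> 0.
  rewrite -[X in _ --> X](mul0r (u N)); apply: cvgMr_tmp.
  by apply: cvg_expr; rewrite ger0_norm.
have d2 : 0 < d / 2 by rewrite divr_gt0.
have [M _ qM] := cvgr0_norm_lt _ qu _ d2.
exists (M + N)%N => // i /= MNi.
have Ni : (N <= i)%N by apply: leq_trans MNi; exact: leq_addl.
rewrite ger0_norm // -(subnK Ni); apply: le_lt_trans (uN _) _.
rewrite [ltRHS](splitr d) ltrD2r; apply: le_lt_trans (ler_norm _) (qM _ _).
by rewrite /= leq_subRL // addnC.
Qed.

Variables (k n : nat) (alpha : boolfun k) (mu : boolfun n -> R).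
Hypothesis alpha_nonlinear : ~ linear_boolfun alpha.
Hypothesis alpha_self_dual : self_dual alpha.
Hypothesis mu_uniform : uniform_over (literals n) mu.
Implicit Types w v : {set cube n}.
Local Notation a := (fourier R alpha).
Local Notation b i w := (bias (growth mu alpha i) w).

Lemma growth_distribution i : Defs.distribution (growth mu alpha i).
Proof.
elim: i => [|i IHi]; first by case: mu_uniform.
exact: growth_step_distribution.
Qed.

Lemma growth_self_dual i f : ~~ self_dual f -> growth mu alpha i f = 0.
Proof.
elim: i f => [|i IHi] f; first exact: uniform_literals_self_dual.
exact: growth_step_self_dual.
Qed.

Lemma bias_growthS i w : w != finset.set0 ->
  b i.+1 w =
  \sum_S a S ^+ #|w| * b i w ^+ #|S| + mixed alpha (growth mu alpha i) w.
Proof. by move=> w0; apply: bias_growth_stepE => //; exact: growth_distribution. Qed.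

Lemma mixed_eq0 i w : (forall v, intermediate w v -> b i v = 0) ->
  mixed alpha (growth mu alpha i) w = 0.
Proof.
move=> b0; apply/normr0_eq0/le_anti; rewrite normr_ge0 andbT.
apply: le_trans (normr_mixed_le alpha w (growth_distribution i)) _.
by rewrite big1 ?mulr0 // => v /b0 ->; rewrite normr0.
Qed.

Lemma mixed_cvg0 w : (forall v, intermediate w v -> b i v @[i --> \oo] --> 0) ->
  mixed alpha (growth mu alpha i) w @[i --> \oo] --> 0.
Proof.
move=> b0; apply/norm_cvg0P.
set N : R := #|{ffun cube n -> {set 'I_k}}|%:R.
have sum0 : N * \sum_(v | intermediate w v) `|b i v| @[i --> \oo] --> 0.
  rewrite -[X in _ --> X](mulr0 N); apply: cvgMl_tmp.
  rewrite [X in _ --> X](_ : _ = \sum_(v | intermediate w v) `|0 : R|).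
    by apply: cvg_finsum => v wv; apply: cvg_norm; exact: b0.
  by rewrite big1 // => v _; rewrite normr0.
apply: squeeze_cvgr _ (cvg_cst 0) sum0.
apply: nearW => i; rewrite normr_ge0 normr_mixed_le //.
exact: growth_distribution.
Qed.

(** A singleton has no intermediate subset, so the recurrence is purely diagonal; it preserves 0
    because the coefficient at the empty set vanishes. *)
Lemma bias1_growth i y : b i [set y]%SET = 0.
Proof.
elim: i => [|i IHi]; first exact: bias_literals1.
have y0 : [set y]%SET != finset.set0 by apply/set0Pn; exists y; rewrite inE.
rewrite bias_growthS // IHi mixed_eq0 ?addr0 => [|v].
  apply: big1 => S _; have [->|S0] := eqVneq S finset.set0.
    by rewrite fourier_set0 // cards1 mul0r.
  by rewrite expr0n cards_eq0 (negbTE S0) mulr0.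
rewrite /intermediate properE subset1 => /andP[/negbTE ->].
by rewrite orbF => /andP[/eqP ->]; rewrite subxx.
Qed.

Lemma bias_growthS_le i w (theta : R) (S0 : {set 'I_k}) :
    (1 < #|w|)%N ->
    `|a S0| ^+ #|w| * `|b i w| ^+ #|S0| <= a S0 ^+ 2 * theta * `|b i w| ->
  `|b i.+1 w| <= (1 - a S0 ^+ 2 + a S0 ^+ 2 * theta) * `|b i w|
                 + `|mixed alpha (growth mu alpha i) w|.
Proof.
move=> w1 hS0; rewrite bias_growthS -?card_gt0 1?ltnW //.
apply: le_trans (ler_normD _ _) _; rewrite lerD2r.
apply: sum_fourier_exp_le => //.
exact: normr_bias_le1 (growth_distribution i).
Qed.

Lemma contraction_ratio (theta c : R) :
  0 <= theta < 1 -> 0 < c <= 1 -> 0 <= 1 - c + c * theta < 1.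
Proof.
move=> /andP[t0 t1] /andP[c0 c1]; have ct0 := mulr_ge0 (ltW c0) t0.
have ct : c * theta < c by rewrite -[ltRHS]mulr1 ltr_pM2l.
by apply/andP; split; lra.
Qed.

Lemma bias_growth_cvg0 w (theta : R) (S0 : {set 'I_k}) :
    (1 < #|w|)%N -> a S0 != 0 -> 0 <= theta < 1 ->
    (forall i, `|a S0| ^+ #|w| * `|b i w| ^+ #|S0| <=
               a S0 ^+ 2 * theta * `|b i w|) ->
    (forall v, intermediate w v -> b i v @[i --> \oo] --> 0) ->
  b i w @[i --> \oo] --> 0.
Proof.
move=> w1 S0n0 theta1 hS0 b0; apply/norm_cvg0P.
have c01 : 0 < a S0 ^+ 2 <= 1 by rewrite exprn_even_gt0 //= S0n0 fourier_sqr_le1.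
apply: (cvg0_contraction (contraction_ratio theta1 c01)) => //.
  by move=> i; exact: bias_growthS_le.
by apply/norm_cvg0P; exact: mixed_cvg0.
Qed.

(** Strong induction on the size of [w]; the contraction has a different source for sizes 1, 2 and
    at least 3. *)
Lemma bias_half_cube_cvg0 (i0 : 'I_n) w :
    w \subset half_cube i0 -> w != finset.set0 ->
  b i w @[i --> \oo] --> 0.
Proof.
have [S0 S1 aS0] := fourier_nonlinear R alpha_self_dual alpha_nonlinear.
have c01 : 0 < a S0 ^+ 2 <= 1 by rewrite exprn_even_gt0 //= aS0 fourier_sqr_le1.
have [m] := ubnP #|w|; elim: m w => // m IHm w wm wH w0.
have IH v : intermediate w v -> b i v @[i --> \oo] --> 0.
  case/andP=> v0 vw; apply: IHm => //.
    exact: leq_trans (proper_card vw) wm.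
  exact: fintype.subset_trans (proper_sub vw) wH.
have bound i := normr_bias_le1 w (growth_distribution i).
case: (ltngtP #|w| 2) => w2.
- have /cards1P[y ->] : #|w| == 1%N by rewrite eqn_leq -ltnS w2 card_gt0.
  by under eq_fun do rewrite bias1_growth; exact: cvg_cst.
(* With at least three points, |a_S0|^|w| <= a_S0^2 |a_S0|, and |a_S0| < 1 since otherwise [alpha]
   would be linear. *)
- apply: (@bias_growth_cvg0 w `|a S0| S0) => //; first exact: ltnW.
    rewrite normr_ge0 lt_neqAle normr_fourier_le1 andbT -sqr_norm_eq1.
    by apply/eqP => /fourier_linear.
  move=> i; apply: ler_pM; rewrite ?exprn_ge0 //.
    rewrite -[X in _ <= X * _]real_normK ?num_real // -exprSr.
    by rewrite ler_wiXn2l ?normr_fourier_le1.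
  by rewrite -[leRHS]expr1 ler_wiXn2l // ltnW.
- have /cards2P[y [z [yz wE]]] : #|w| == 2 by rewrite w2.
  have b0 : `|bias mu w| < 1.
    have yzH x : x \in w -> x i0 = false.
      by move=> /(fintype.subsetP wH); rewrite inE => /negbTE.
    rewrite wE; apply: (bias_literals2 mu_uniform (i0 := i0)) yz.
    by rewrite !yzH // wE !inE eqxx ?orbT.
  have theta01 : 0 <= `|bias mu w| < 1 by rewrite normr_ge0.
  (* As |S0| >= 2, |b|^|S0| <= |b|^2, so an initial bias below 1 serves as [theta] while the bias
     does not exceed it. *)
  have hS0 i : `|b i w| <= `|bias mu w| ->
      `|a S0| ^+ #|w| * `|b i w| ^+ #|S0| <= a S0 ^+ 2 * `|bias mu w| * `|b i w|.
    move=> bi; rewrite w2 real_normK ?num_real // -mulrA ler_wpM2l ?sqr_ge0 //.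
    by apply: (@le_trans _ _ (`|b i w| ^+ 2)); rewrite ?ler_wiXn2l // expr2 ler_wpM2r.
  apply: (@bias_growth_cvg0 w `|bias mu w| S0) => //; first by rewrite w2.
  (* The bias of a pair never exceeds its initial value: [mixed] is exactly 0 here, as it involves
     only singletons. *)
  move=> i; apply: (hS0); elim: i => [//|i IHi].
  apply: le_trans (bias_growthS_le _ (hS0 i IHi)) _; first by rewrite w2.
  rewrite mixed_eq0 ?normr0 ?addr0 => [|v /andP[v0 /proper_card]].
    apply: le_trans IHi; rewrite ler_piMl //.
    by have /andP[_ /ltW] := contraction_ratio theta01 c01.
  rewrite w2 ltnS => v1; have /cards1P[x ->] : #|v| == 1%N.
    by rewrite eqn_leq v1 card_gt0.
  exact: bias1_growth.
Qed.

Lemma growth_cvg_self_dual (i0 : 'I_n) f : self_dual f ->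
  growth mu alpha i f @[i --> \oo] --> (2 ^- #|half_cube i0| : R).
Proof.
move=> sdf.
rewrite (funext (fun i => half_cube_inversion i0 (@growth_self_dual i) sdf)).
rewrite -[X in _ --> X]mulr1; apply: cvgMl_tmp.
(* In the limit only the empty character survives, with bias 1. *)
have -> : 1 = \sum_(w : {set cube n} | w \subset half_cube i0)
                 (if w == finset.set0 then 1 else 0 : R).
  rewrite (bigD1 finset.set0) ?finset.sub0set //= eqxx big1 ?addr0 // => w.
  by case/andP=> _ /negbTE ->.
apply: cvg_finsum => w wH; case: ifPn => [/eqP ->|w0].
  have one i : walsh R finset.set0 f * b i finset.set0 = 1.
    by rewrite (bias_set0 (growth_distribution i)) mulr1 /walsh finset.big_set0.
  by rewrite (funext one); exact: cvg_cst.
rewrite -[X in _ --> X](mulr0 (walsh R w f)); apply: cvgMl_tmp.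
exact: bias_half_cube_cvg0 wH w0.
Qed.

(** Obtained from the process itself: the total mass is 1 at every step and tends to the number of
    self-dual functions times their common limit. *)
Lemma card_self_dual (i0 : 'I_n) :
  #|[set f : boolfun n | self_dual f]%SET|%:R^-1 = 2 ^- #|half_cube i0| :> R.
Proof.
set D := #|_|; set h := #|_|.
suff : D%:R * 2 ^- h = 1 :> R.
  move=> Dh; apply: (mulfI (_ : D%:R != 0 :> R)).
    by apply: contra_eq_neq Dh => ->; rewrite mul0r eq_sym oner_eq0.
  rewrite Dh mulfV //; apply: contra_eq_neq Dh => ->.
  by rewrite mul0r eq_sym oner_eq0.
apply: (@cvg_unique _ (@norm_hausdorff _ R) (\sum_f growth mu alpha i f @[i --> \oo])).
- rewrite mulr_natl -sumr_const big_mkcond.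
  apply: cvg_finsum => f _; rewrite inE; case: ifPn => [|nsd].
    exact: growth_cvg_self_dual.
  by under eq_fun do rewrite growth_self_dual //; exact: cvg_cst.
- by rewrite (funext (fun i => proj2 (growth_distribution i))); exact: cvg_cst.
Qed.

End Convergence.

Theorem theorem4p1 (R : realType) (k n : nat) (alpha : boolfun k)
    (mu : boolfun n -> R)
    (alpha_nonlinear : ~ linear_boolfun alpha)
    (alpha_self_dual : self_dual alpha)
    (mu_uniform : uniform_over (literals n) mu) :
  exists p : boolfun n -> R,
    limiting_distribution mu alpha p /\
    uniform_over [set f : boolfun n | self_dual f]%SET p.
Proof.
have [i0 _] := uniform_literals_index mu_uniform.
pose SD := [set f : boolfun n | self_dual f]%SET.
pose p f : R := if f \in SD then #|SD|%:R^-1 else 0.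
(* A self-dual function exists, so the uniform law has total mass 1. *)
have proj_SD : Defs.proj i0 \in SD.
  by rewrite inE; apply/forallP => y; rewrite !ffunE negbK.
have dp : Defs.distribution p.
  split=> [f|]; first by rewrite /p; case: ifP; rewrite ?invr_ge0.
  rewrite -big_mkcond sumr_const -[LHS]mulr_natl mulfV // pnatr_eq0 -lt0n card_gt0.
  by apply/set0Pn; exists (Defs.proj i0).
exists p; split; last by split.
split=> // f; rewrite /p inE; case: ifPn => [sdf|nsd].
  by rewrite (card_self_dual alpha_nonlinear alpha_self_dual mu_uniform i0);
     exact: growth_cvg_self_dual.
under eq_fun do rewrite (growth_self_dual alpha_self_dual mu_uniform) //.
exact: cvg_cst.
Qed.
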